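(* Let $n>2$ and $k>1$ be integers, and let \[ F_{n,k}(x) := \Phi_n(1+x+\cdots+x^k), \] where $\Phi_n$ denotes the $n$-th cyclotomic polynomial. (i) If $k$ is even, then $F_{n,k}(x)$ is reducible in $\mathbb{Q}[x]$ if and only if $n \mid (k+2)$. In that case, $F_{n,k}(x)$ has precisely two irreducible factors in $\mathbb{Q}[x]$. (ii) If $k$ is odd, then $F_{n,k}(x)$ is reducible in $\mathbb{Q}[x]$ if and only if $n$ is even and $n \mid 2(k+2)$. In that case, $F_{n,k}(x)$ has precisely two irreducible factors in $\mathbb{Q}[x]$.
   Context: The $n$-th cyclotomic polynomial is $\Phi_n(x) = \prod_{1\le j\le n,\ \gcd(j,n)=1}\left(x-e^{2\pi i j/n}\right)$, i.e. the minimal polynomial over $\mathbb{Q}$ of any primitive $n$-th root of unity. *)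

(* Defs.v *)
From mathcomp Require Import all_boot all_order all_algebra all_field.

Set Implicit Arguments.
Unset Strict Implicit.
Unset Printing Implicit Defensive.

Import GRing.Theory.
Local Open Scope ring_scope.

(* ['Phi_n] has type [{poly int}]; it is mapped into [{poly rat}] before the
   composition, and [p \Po q] is p(q(x)). *)
Definition Fnk (n k : nat) : {poly rat} :=
  map_poly (intr : int -> rat) 'Phi_n \Po (\sum_(i < k.+1) 'X^i).

(* The nonzero nonunits of [{poly F}] are the polynomials of size > 1. *)
Definition reducible_poly (F : fieldType) (p : {poly F}) : Prop :=
  exists q r : {poly F}, [/\ (1 < size q)%N, (1 < size r)%N & p = q * r].

(* The two factors are required to be non-associate, so that the count is two
   both with and without multiplicity. *)
Definition two_irreducible_factors (F : fieldType) (p : {poly F}) : Prop :=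
  exists q r : {poly F},
    [/\ irreducible_poly q, irreducible_poly r, ~~ (q %= r) & p = q * r].

(* Main.v *)
Require Import Defs.
From mathcomp Require Import all_boot all_order all_fingroup all_algebra all_field.
From mathcomp Require Import all_character.
From mathcomp Require Import ring zify.

(** Let w be a primitive n-th root of unity, L = Q(w), and
    g = 1 + X + ... + X^k - w. Then F_{n,k} is the product of the Galois
    conjugates of g, which are pairwise coprime since they differ by nonzero
    constants; hence the factorization of F_{n,k} over Q mirrors that of g
    over L. Now (X - 1) g = X^(k+1) - w X + w - 1 is a trinomial a, to which
    Ljunggren's method applies. Let ~ denote the conjugate reciprocal. If
    a = p q with p, q monic, then b = p q~ satisfies b b~ = a a~. Comparing
    the coefficients of X^(k+1) under all embeddings, using
    |b_0 b_(k+1)| = |1 - w| < 2 and the fact that the mean of |x|^2 over the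
    conjugates of a nonzero algebraic integer x is at least 1, one finds that
    b has at most one nonzero coefficient besides b_0 and b_(k+1). This
    forces b to be a constant multiple of a or of a~, so that q or p divides
    both a and a~, and therefore (X - 1)(X + 1/w). Thus g is irreducible up to
    a simple factor X + 1/w, which occurs iff w^(k+2) = (-1)^k. *)

Set Implicit Arguments.
Unset Strict Implicit.
Unset Printing Implicit Defensive.

Import Order.TTheory GRing.Theory Num.Theory.
Local Open Scope ring_scope.

(** * Norms of polynomials over a Galois extension *)

(** The product is kept in [{poly L}], where it can be compared with [d]; [norm_poly_descent] brings
    it down to [F]. *)
Definition norm_poly (F : fieldType) (L : splittingFieldType F) (d : {poly L}) : {poly L} :=
  \prod_(s in 'Gal({:L} / 1)%g) map_poly (s : L -> L) d.

Lemma coprimep_prodr (F : fieldType) (I : Type) (r : seq I) (P : pred I)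
    (E : I -> {poly F}) (q : {poly F}) :
  (forall i, P i -> coprimep q (E i)) -> coprimep q (\prod_(i <- r | P i) E i).
Proof.
move=> co; elim/big_rec: _ => [|i p Pi co_p]; first exact: coprimep1.
by rewrite coprimepMr co.
Qed.

Lemma dvdp_prod_coprime (F : fieldType) (I : eqType) (r : seq I) (P : pred I)
    (E : I -> {poly F}) (q : {poly F}) :
    uniq r -> (forall i j, P i -> P j -> i != j -> coprimep (E i) (E j)) ->
    (forall i, P i -> E i %| q) ->
  \prod_(i <- r | P i) E i %| q.
Proof.
move=> Ur co dv; elim: r Ur => [|i r IH] /=; first by rewrite big_nil dvd1p.
case/andP=> ir Ur; rewrite big_cons; case: ifP => Pi; last exact: IH.
rewrite Gauss_dvdp ?dv ?IH // big_seq_cond.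
apply: coprimep_prodr => j /andP[jr Pj]; apply: co => //.
by apply: contraNneq ir => ->.
Qed.

Lemma comp_prod_poly (R : comNzRingType) (I : Type) (r : seq I) (P : pred I)
    (E : I -> {poly R}) (q : {poly R}) :
  (\prod_(i <- r | P i) E i) \Po q = \prod_(i <- r | P i) (E i \Po q).
Proof.
elim/big_rec2: _ => [|i p1 p2 _ <-]; first by rewrite comp_polyC.
by rewrite comp_polyM.
Qed.

Lemma irreducible_not_reducible (F : fieldType) (p q r : {poly F}) :
  irreducible_poly p -> (1 < size q)%N -> (1 < size r)%N -> p != q * r.
Proof.
move=> irr szq szr; apply/eqP => Dp.
have q0 : q != 0 by rewrite -size_poly_gt0 ltnW.
have r0 : r != 0 by rewrite -size_poly_gt0 ltnW.
have /eqp_size : q %= p by apply: irr; rewrite ?Dp ?dvdp_mulr // gtn_eqF.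
rewrite Dp size_mul // => E; move: szq szr E; move: (size q) (size r) => a b; lia.
Qed.

Lemma map_norm_poly (F : fieldType) (L : splittingFieldType F) (d : {poly L})
    (t : gal_of {:L}) :
  t \in 'Gal({:L} / 1)%g -> map_poly (t : L -> L) (norm_poly d) = norm_poly d.
Proof.
move=> Gt; rewrite /norm_poly rmorph_prod [RHS](reindex_inj (mulIg t)) /=.
apply: eq_big => [s|s _]; first by rewrite groupMr.
by rewrite -map_poly_comp; apply: eq_map_poly => x; rewrite /= galM ?memvf.
Qed.

Lemma norm_poly_descent (F : fieldType) (L : splittingFieldType F) (d : {poly L}) :
  galois 1 {:L} -> exists p : {poly F}, map_poly (in_alg L) p = norm_poly d.
Proof.
move=> /galois_fixedField fixL.
have coefF i : exists a : F, in_alg L a = (norm_poly d)`_i.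
  suff : (norm_poly d)`_i \in 1%AS by case/vlineP => a ->; exists a.
  rewrite -fixL; apply/fixedFieldP; rewrite ?memvf // => s Gs.
  by rewrite -[in RHS](map_norm_poly d Gs) coef_map.
have /fin_all_exists[a Da] (i : 'I_(size (norm_poly d))) := coefF i.
(* [insub] only turns [i] into an ordinal; the default [0] is never reached, since [i] is below the
   size. *)
exists (\poly_(i < size (norm_poly d)) if insub i is Some j then a j else 0).
apply/polyP => i; rewrite coef_map coef_poly; case: ltnP => ltis.
  by rewrite insubT; apply: (Da (Ordinal ltis)).
by rewrite [LHS](rmorph0 (in_alg L)) nth_default.
Qed.

Lemma norm_polyM (F : fieldType) (L : splittingFieldType F) (d e : {poly L}) :
  norm_poly (d * e) = norm_poly d * norm_poly e.
Proof. by rewrite /norm_poly -big_split; apply: eq_bigr => s _; rewrite rmorphM. Qed.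

(** This makes the conjugates of [d] pairwise coprime, so that a polynomial over [F] divisible by
    [d] is divisible by its whole norm. *)
Definition coprime_conjugates (F : fieldType) (L : splittingFieldType F) (d : {poly L}) :=
  forall s : gal_of {:L}, s \in 'Gal({:L} / 1)%g -> s != 1%g ->
    coprimep d (map_poly (s : L -> L) d).

Lemma coprime_conjugates_dvd (F : fieldType) (L : splittingFieldType F) (d e : {poly L}) :
  d %| e -> coprime_conjugates e -> coprime_conjugates d.
Proof.
move=> de co s Gs s1; apply: coprimep_dvdl (coprimep_dvdr de (co s Gs s1)).
by rewrite dvdp_map.
Qed.

Lemma dvdp_norm_poly (F : fieldType) (L : splittingFieldType F) (d : {poly L}) :
  d %| norm_poly d.
Proof.
rewrite /norm_poly (bigD1 1%g) ?group1 //= dvdp_mulr //.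
by rewrite map_poly_id // => x _; rewrite gal_id.
Qed.

(** A nonunit factor [q] of [p] shares a factor with some conjugate of [d]. Since [q] is fixed by
    the Galois group, it shares one with [d], so [d] and then every conjugate of [d] divides [q]. By
    pairwise coprimality the norm divides [q]. *)
Lemma norm_poly_irreducible (F : fieldType) (L : splittingFieldType F)
    (d : {poly L}) (p : {poly F}) :
    irreducible_poly d -> coprime_conjugates d ->
    map_poly (in_alg L) p %= norm_poly d ->
  irreducible_poly p.
Proof.
move=> irr co eqp_p.
have map_in (s : gal_of {:L}) (q : {poly F}) : s \in 'Gal({:L} / 1)%g ->
  map_poly (s : L -> L) (map_poly (in_alg L) q) = map_poly (in_alg L) q.
  move=> Gs; rewrite -map_poly_comp; apply: eq_map_poly => x /=.
  by apply: (fixed_gal _ Gs); rewrite ?sub1v // rpredZ ?mem1v.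
have p0 : p != 0.
  rewrite -(map_poly_eq0 (in_alg L)) -size_poly_eq0 (eqp_size eqp_p) size_poly_eq0; apply/prodf_neq0 => s _.
  by rewrite map_poly_eq0 irredp_neq0.
have dp : d %| map_poly (in_alg L) p by rewrite (eqp_dvdr _ eqp_p) dvdp_norm_poly.
split=> [|q q1 qp].
  rewrite -(size_map_poly (in_alg L)); apply: leq_trans irr.1 (dvdp_leq _ dp).
  by rewrite map_poly_eq0.
pose q' := map_poly (in_alg L) q.
have : ~~ coprimep q' (norm_poly d).
  apply: contra q1; rewrite -(eqp_coprimepr _ eqp_p) coprimep_map => co_q.
  by rewrite -coprimepp; apply: coprimep_dvdl co_q.
move=> /negP nco.
have [s Gs sq] : exists2 s : gal_of {:L}, s \in 'Gal({:L} / 1)%g & ~~ coprimep q' (map_poly (s : L -> L) d).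
  apply/exists_inP; rewrite -[X in is_true X]negbK negb_exists_in; apply/negP => /forall_inP all_co.
  by apply: nco; apply: coprimep_prodr => s Gs; move: (all_co s Gs); rewrite negbK.
have dq : d %| q'.
  have Eq : map_poly (s : L -> L) q' = q' := map_in s q Gs.
  rewrite -Eq coprimep_map coprimep_sym in sq.
  by move: sq; rewrite (irreducible_poly_coprime _ irr) negbK.
have : norm_poly d %| q'.
  clear s Gs sq; apply: dvdp_prod_coprime => [|s t|t]; first exact: index_enum_uniq; last first.
    by move=> Gs; rewrite -[q'](map_in t q Gs) dvdp_map.
  (* Undoing [s] reduces the claim to [d] and its conjugate by [t * s^-1], where the left factor
     acts first. *)
  move=> Gs Gt st.
  have -> : map_poly (t : L -> L) d =
      map_poly (s : L -> L) (map_poly ((t * s^-1)%g : L -> L) d).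
    rewrite -map_poly_comp; apply: eq_map_poly => x /=.
    by rewrite -galM ?memvf // mulgKV.
  rewrite coprimep_map; apply: co; first by rewrite groupM ?groupV.
  by rewrite -eq_mulgV1 eq_sym.
rewrite -(eqp_dvdl _ eqp_p) dvdp_map => pq.
by rewrite /eqp qp.
Qed.

(** * Cyclotomic fields *)

(* AM-GM applied to the norm of [a], a nonzero rational integer. *)
Lemma galois_sum_norm_ge (L : splittingFieldType rat) (f : {rmorphism L -> algC}) (a : L) :
    galois 1 {:L} -> a != 0 -> f a \in Aint ->
  #|'Gal({:L} / 1)%g|%:R <= \sum_(s in 'Gal({:L} / 1)%g) `|f (s a)| ^+ 2.
Proof.
move=> galL a0 Za; set G := 'Gal({:L} / 1)%g.
have Gt0 : (0 < #|G|)%N := cardG_gt0 _.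
pose N := \prod_(s in G) f (s a).
(* [N] is a field norm, hence rational; its factors are images of [f a] under automorphisms of
   [algC], hence algebraic integers. *)
have ZN : N \in Num.int.
  apply: Cint_rat_Aint; last first.
    rewrite rpred_prod // => s _.
    by have [nu Dnu] := extend_algC_subfield_aut f s; rewrite Dnu Aint_aut.
  have -> : N = f (galNorm 1 {:L} a) by rewrite rmorph_prod.
  have /vlineP[q ->] := mem_galNorm galL (memvf a).
  by rewrite rmorphZ_num rmorph1 mulr1 Crat_rat.
have N_ge1 : 1 <= \prod_(s in G) `|f (s a)| ^+ 2.
  have -> : \prod_(s in G) `|f (s a)| ^+ 2 = `|N| ^+ 2.
    by rewrite /N (big_morph Num.norm (@normrM _) (@normr1 _)) -prodrXl.
  rewrite intr_normK // sqr_intr_ge1 //; apply/prodf_neq0 => s _.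
  by rewrite !fmorph_eq0.
rewrite -[X in X <= _]mul1r -ler_pdivlMr ?ltr0n //.
rewrite -(expr_ge1 Gt0); last by rewrite divr_ge0 ?ler0n ?sumr_ge0 // => s _; rewrite exprn_ge0.
by rewrite (le_trans N_ge1) // leif_AGM // => s _; rewrite exprn_ge0.
Qed.

(** [group_num_field_exists] attaches such a field to a group of order [n]; a cyclic one is used.
    The map [c] is complex conjugation, which restricts to the normal field [L]. *)
Lemma cyclotomic_field_exists (n : nat) : (1 < n)%N ->
  exists (L : splittingFieldType rat) (f : {rmorphism L -> algC})
         (c : {rmorphism L -> L}) (w : L),
    [/\ galois 1 {:L}, forall x, f (c x) = (f x)^*,
        n.-primitive_root w & <<1; w>>%VS = fullv].
Proof.
move=> n1; have [L galL [f _ [w [prim_w genL] _]]] := group_num_field_exists (Zp_group n).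
rewrite card_Zp ?(ltnW n1) // in prim_w.
have [c Dc] := restrict_aut_to_normal_num_field f (@Num.conj _ : {rmorphism algC -> algC}).
by exists L, f, c, w.
Qed.

Lemma rmorph_Fadjoin_eq (F : fieldType) (L : fieldExtType F) (w : L)
    (phi psi : {rmorphism L -> L}) :
    <<1; w>>%VS = fullv -> (forall a : F, phi a%:A = psi a%:A) -> phi w = psi w ->
  phi =1 psi.
Proof.
move=> genL eqF eqw x.
have /Fadjoin_polyP[p /polyOverP Kp ->] : x \in <<1; w>>%VS by rewrite genL memvf.
rewrite -!horner_map /= eqw; congr (_.[_]); apply/polyP => i.
by rewrite !coef_map /=; have /vlineP[a ->] := Kp i.
Qed.

Lemma norm_prim_root (n : nat) (L : fieldType) (f : {rmorphism L -> algC}) (w : L) :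
  n.-primitive_root w -> `|f w| = 1.
Proof.
move=> prim_w; have n0 := prim_order_gt0 prim_w.
by apply/eqP; rewrite -(@pexpr_eq1 _ _ n) // -normrX -rmorphXn prim_expr_order // rmorph1 normr1.
Qed.

Lemma prim_root_rmorph_inv (n : nat) (L : fieldType) (f : {rmorphism L -> algC})
    (c : L -> L) (w : L) :
  (forall x, f (c x) = (f x)^*) -> n.-primitive_root w -> c w = w^-1.
Proof.
move=> Dc prim_w; apply: (fmorph_inj f); rewrite Dc fmorphV /=.
by rewrite invC_norm (norm_prim_root f prim_w) expr1n invr1 mul1r.
Qed.

(** Both composites send [w] to the inverse of [s w], and [w] generates [L]. Hence [x * c x] becomes
    a squared absolute value under every embedding [f \o s], not only under [f]. *)
Lemma gal_conj_commute (n : nat) (L : splittingFieldType rat) (f : {rmorphism L -> algC})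
    (c : {rmorphism L -> L}) (w : L) (s : gal_of {:L}) :
    (forall x, f (c x) = (f x)^*) -> n.-primitive_root w -> <<1; w>>%VS = fullv ->
  forall x, s (c x) = c (s x).
Proof.
move=> Dc prim_w genL x.
have pr_sw: n.-primitive_root (s w) by rewrite fmorph_primitive_root.
apply: (@rmorph_Fadjoin_eq _ _ w (s \o c) (c \o s)) => //= [a|].
  by rewrite alg_num_field !fmorph_rat.
by rewrite (prim_root_rmorph_inv Dc prim_w) (prim_root_rmorph_inv Dc pr_sw) fmorphV.
Qed.

(** An automorphism fixing [w] is trivial, so a nontrivial [s] changes the polynomial by the nonzero
    constant [w - s w]. *)
Lemma coprime_conjugates_XsubC (F : fieldType) (L : splittingFieldType F) (w : L) (q : {poly F}) :
  <<1; w>>%VS = fullv -> coprime_conjugates (map_poly (in_alg L) q - w%:P).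
Proof.
move=> genL s Gs s1.
rewrite rmorphB /= map_polyC /=.
have -> : map_poly (s : L -> L) (map_poly (in_alg L) q) = map_poly (in_alg L) q.
  rewrite -map_poly_comp; apply: eq_map_poly => x /=.
  by apply: (fixed_gal _ Gs); rewrite ?sub1v // rpredZ ?mem1v.
set p := map_poly _ q.
have sw : w - s w != 0.
  apply: contra s1; rewrite subr_eq0 eq_sym => sw.
  rewrite -genL in s Gs sw *.
  by rewrite (gal_adjoin_eq Gs (group1 _)) gal_id.
have -> : p - (s w)%:P = 1 * (p - w%:P) + (w - s w)%:P by rewrite polyCB; ring.
rewrite coprimep_addl_mul.
by rewrite (eqp_coprimepr _ (_ : _ %= 1)) ?coprimep1 // polyC_eqp1.
Qed.

(** The norm descends to a monic irreducible rational polynomial vanishing at [f w]; it is therefore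
    the minimal polynomial of [f w], which is cyclotomic. *)
Lemma Cyclotomic_norm_poly (n : nat) (L : splittingFieldType rat)
    (f : {rmorphism L -> algC}) (w : L) :
    galois 1 {:L} -> n.-primitive_root w -> <<1; w>>%VS = fullv ->
  map_poly (in_alg L) (map_poly intr 'Phi_n) = norm_poly ('X - w%:P).
Proof.
move=> galL prim_w genL; have [p Dp] := norm_poly_descent ('X - w%:P) galL.
have in_algC q : map_poly f (map_poly (in_alg L) q) = map_poly ratr q.
  by rewrite -map_poly_comp; apply: eq_map_poly => a /=; rewrite alg_num_field fmorph_rat.
have irr_p : irreducible_poly p.
  apply: (norm_poly_irreducible (irredp_XsubC w)); last by rewrite Dp eqpxx.
  by have := coprime_conjugates_XsubC 'X genL; rewrite map_polyX.
have prim_fw : n.-primitive_root (f w) by rewrite fmorph_primitive_root.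
have [q [Dq mon_q dv_q]] := minCpolyP (f w).
have Eq : q = map_poly intr 'Phi_n.
  apply: (map_poly_inj (ratr : {rmorphism rat -> algC})); rewrite -Dq (minCpoly_cyclotomic prim_fw).
  rewrite -(Cintr_Cyclotomic prim_fw) -map_poly_comp; apply: eq_map_poly => b /=.
  by rewrite rmorph_int.
have mon_p : p \is monic.
  rewrite -(map_monic (in_alg L)) Dp; apply: rpred_prod => s _.
  by rewrite map_polyXsubC monicXsubC.
have /eqP -> : map_poly intr 'Phi_n == p; last by [].
rewrite -Eq -eqp_monic //; apply: irr_p; last first.
  rewrite -dv_q -in_algC Dp fmorph_root.
  by rewrite -dvdp_XsubCl dvdp_norm_poly.
by have := size_minCpoly (f w); rewrite Dq size_map_poly; case: ltngtP.
Qed.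

(** * Reciprocal polynomials and the trinomial *)

(* [m] plays the role of the degree: the coefficients of [p] above [m] are lost. *)
Definition recip (R : nzRingType) (m : nat) (p : {poly R}) : {poly R} :=
  \poly_(i < m.+1) p`_(m - i).

Lemma coef_recip (R : nzRingType) (m : nat) (p : {poly R}) (i : nat) :
  (i <= m)%N -> (recip m p)`_i = p`_(m - i).
Proof. by move=> le_im; rewrite coef_poly ltnS le_im. Qed.

Lemma recipE (R : nzRingType) (m : nat) (p : {poly R}) :
  recip m p = \sum_(i < m.+1) p`_i *: 'X^(m - i).
Proof.
rewrite /recip poly_def (reindex_inj rev_ord_inj) /=; apply: eq_bigr => i _.
by rewrite subSS subKn // -ltnS.
Qed.

(** The size bounds ensure that no coefficient is lost, and bilinearity reduces the claim to
    monomials. *)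
Lemma recipM (R : comNzRingType) (m l : nat) (p q : {poly R}) :
    (size p <= m.+1)%N -> (size q <= l.+1)%N ->
  recip (m + l) (p * q) = recip m p * recip l q.
Proof.
move=> szp szq.
have recipD : {morph @recip R (m + l) : r s / r + s}.
  by move=> r s; apply/polyP=> i; rewrite coefD !coef_poly; case: ifP; rewrite ?coefD ?addr0.
have recip0 : @recip R (m + l) 0 = 0.
  by apply/polyP=> i; rewrite coef_poly !coef0; case: ifP.
have poly_sum (r : {poly R}) (d : nat) : (size r <= d)%N -> r = \sum_(i < d) r`_i *: 'X^i.
  by move=> szr; rewrite -poly_def; apply/polyP=> i; rewrite coef_poly; case: ltnP => // /(leq_trans szr) ?; rewrite nth_default.
rewrite [in LHS](poly_sum p _ szp) [in LHS](poly_sum q _ szq) (recipE m) (recipE l) !big_distrl /=.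
rewrite (big_morph _ recipD recip0); apply: eq_bigr => i _.
rewrite !big_distrr /= (big_morph _ recipD recip0); apply: eq_bigr => j _.
have [Hi Hj] : (i <= m /\ j <= l)%N by case: i j => [i Hi] [j Hj].
rewrite -!scalerAl -!scalerAr !scalerA -!exprD.
apply/polyP => t; rewrite coef_poly !coefZ !coefXn.
case: ifP => [|/negbT] Ht; last by rewrite [t == _]gtn_eqF ?mulr0 //; lia.
by congr (_ * _%:R); congr nat_of_bool; lia.
Qed.

Lemma recipK (R : nzRingType) (m : nat) (p : {poly R}) :
  (size p <= m.+1)%N -> recip m (recip m p) = p.
Proof.
move=> szp; apply/polyP => i; rewrite coef_poly; case: ltnP => Hi.
  by rewrite coef_recip ?leq_subr // subKn.
by rewrite nth_default // (leq_trans szp).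
Qed.

Lemma map_recip (R S : nzRingType) (c : {rmorphism R -> S}) (m : nat) (p : {poly R}) :
  map_poly c (recip m p) = recip m (map_poly c p).
Proof.
by apply/polyP => i; rewrite coef_map [in LHS]coef_poly [in RHS]coef_poly coef_map /=; case: ifP => _ /=; rewrite ?rmorph0.
Qed.

Lemma recipZ (R : nzRingType) (m : nat) (a : R) (p : {poly R}) :
  recip m (a *: p) = a *: recip m p.
Proof.
by apply/polyP => i; rewrite coefZ !coef_poly coefZ; case: ifP; rewrite ?mulr0.
Qed.

Lemma size_recip (R : nzRingType) (m : nat) (p : {poly R}) : (size (recip m p) <= m.+1)%N.
Proof. exact: size_poly. Qed.

(** These are the autocorrelations of the coefficients of [p]: [i = 0] pairs the two extreme ones,
    and [i = m] gives the sum of all [p_j * c p_j]. *)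
Lemma coef_mul_recip (R : nzRingType) (m i : nat) (c : {rmorphism R -> R}) (p : {poly R}) :
    (i <= m)%N ->
  (p * recip m (map_poly c p))`_i = \sum_(j < i.+1) p`_j * c p`_(m - i + j).
Proof.
move=> Him; rewrite coefM; apply: eq_bigr => -[j /=]; rewrite ltnS => Hj _.
rewrite coef_recip ?(leq_trans (leq_subr _ _)) // coef_map /=; congr (_ * c p`_ _).
lia.
Qed.

(* (X - 1)(1 + X + ... + X^k - w), see [trinomE]. *)
Definition trinom (R : nzRingType) (k : nat) (w : R) : {poly R} :=
  'X^(k.+1) - w *: 'X + (w - 1)%:P.

Lemma coef_trinom (R : nzRingType) (k : nat) (w : R) (i : nat) : (1 < k)%N ->
  (trinom k w)`_i = if i == 0%N then w - 1 else if i == 1%N then - w else (i == k.+1)%:R.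
Proof.
move=> k1; rewrite /trinom coefD coefB coefXn coefZ coefX coefC.
case: i => [|[|i]] //=; rewrite ?mulr0 ?mulr1 ?subr0 ?addr0 ?add0r //.
by rewrite (_ : (1 == k.+1)%N = false) ?sub0r // eqSS; case: k k1.
Qed.

Lemma size_trinom (R : nzRingType) (k : nat) (w : R) : (1 < k)%N -> size (trinom k w) = k.+2.
Proof.
move=> k1; apply/eqP; rewrite eqn_leq; apply/andP; split.
  apply/leq_sizeP => i Hi; rewrite coef_trinom //.
  by case: i Hi => [|[|i]] //= Hi; rewrite [_ == _]gtn_eqF.
rewrite ltnNge; apply/negP => /leq_sizeP/(_ k.+1 (leqnn _))/eqP.
by rewrite coef_trinom // eqxx eqSS [k == _]gtn_eqF ?oner_eq0 // ltnW.
Qed.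

(** The first three values determine [b] in [low_autocorrelation]; the last one becomes
    [2 + |w - 1|^2] under an embedding and bounds the size of [b]. *)
Lemma trinom_coefs (L : fieldType) (k : nat) (c : {rmorphism L -> L}) (w : L) :
    (1 < k)%N -> w != 0 -> c w = w^-1 ->
  let D := trinom k w * recip k.+1 (map_poly c (trinom k w)) in
  [/\ D`_0 = w - 1, D`_1 = - w, D`_k = w^-1 - 1
    & D`_k.+1 = 1 + w * w^-1 + (w - 1) * (w^-1 - 1)].
Proof.
case: k => [//|k] k1 w0 cw D; rewrite /D.
have ak : (trinom k.+1 w)`_k.+1 = 0.
  by rewrite coef_trinom // [k.+1 == 0%N]gtn_eqF // [k.+1 == 1%N]gtn_eqF // ltn_eqF.
have ak1 : (trinom k.+1 w)`_k.+2 = 1.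
  by rewrite coef_trinom // eqxx eqSS [k.+1 == _]gtn_eqF.
have a0 : (trinom k.+1 w)`_0 = w - 1 by rewrite coef_trinom.
have a1 : (trinom k.+1 w)`_1 = - w by rewrite coef_trinom.
have amid i : (1 < i)%N -> (i <= k.+1)%N -> (trinom k.+1 w)`_i = 0.
  by move=> i1 ik; rewrite coef_trinom // [i == 0%N]gtn_eqF 1?ltnW // [i == 1%N]gtn_eqF // ltn_eqF.
split; rewrite coef_mul_recip //.
- by rewrite big_ord1 subn0 addn0 ak1 rmorph1 mulr1 a0.
- rewrite 2!big_ord_recl big_ord0 /= addn0 subn1 /= ak rmorph0 mulr0 add0r addr0.
  by rewrite addn1 ak1 rmorph1 mulr1 a1.
- rewrite big_ord_recl big1 => [|j _].
    by rewrite subSnn a0 a1 rmorphN cw addr0; field.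
  rewrite subSnn /= /bump /= !add1n.
  have [jk|jk] := eqVneq j.+1 k.+1; first by rewrite jk ak mul0r.
  by rewrite (amid j.+2) ?rmorph0 ?mulr0 //; have := ltn_ord j; lia.
- rewrite 2!big_ord_recl big_ord_recr /= big1 => [|j _].
    by rewrite subnn !add0n /bump /= !add1n a0 a1 ak1 rmorphB rmorphN rmorph1 cw; ring.
  by rewrite /bump /= !add1n amid ?mul0r //; apply: (ltn_ord j).
Qed.

(** * Ljunggren's method *)

(** Only [b_0], [b_1] and [b_(k+1)] survive, and their pairwise products, up to conjugation, are
    known from [D_0], [D_1] and [D_k]. These force [b_(k+1)] to have norm one, and then fix the
    ratios to it. *)
Lemma low_autocorrelation (L : fieldType) (k : nat) (c : {rmorphism L -> L}) (w : L)
    (b : {poly L}) (a := trinom k w) :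
    (1 < k)%N -> involutive c -> w != 0 -> w != 1 -> c w = w^-1 ->
    (size b <= k.+2)%N -> (forall i, (1 < i)%N -> (i <= k)%N -> b`_i = 0) ->
    b * recip k.+1 (map_poly c b) = a * recip k.+1 (map_poly c a) ->
  b = b`_k.+1 *: a.
Proof.
move=> k1 cK w0 w1 cw szb midb Eba.
have [D0 D1 Dk _] := trinom_coefs k1 w0 cw.
rewrite -/a -{}Eba in D0 D1 Dk.
have E0 : b`_0 * c b`_k.+1 = w - 1.
  by rewrite -D0 coef_mul_recip // big_ord1 subn0 addn0.
have E1 : b`_1 * c b`_k.+1 = - w.
  rewrite -D1 coef_mul_recip // 2!big_ord_recl big_ord0 /= addn0 subn1 /= addn1 addr0.
  by rewrite (midb k) // rmorph0 mulr0 add0r.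
have Ek : b`_0 * c b`_1 = w^-1 - 1.
  rewrite -Dk coef_mul_recip // subSnn big_ord_recl big1 => [|j _]; first by rewrite addr0.
  rewrite /= /bump /= !add1n; have [jk|jk] := eqVneq j.+1 k.
    by rewrite [b`_(j.+1)]midb ?mul0r ?jk.
  by rewrite (midb j.+2) ?rmorph0 ?mulr0 //; have := ltn_ord j; lia.
have w1' : w - 1 != 0 by rewrite subr_eq0.
have u0 : b`_0 != 0 by apply: contraNneq w1' => u0; rewrite -E0 u0 mul0r.
(* Since [w^-1 - 1 = - w^-1 * (w - 1)], [Ek] and [E0] express [c b_1] through [c b_(k+1)]; the
   conjugate of [E1] then gives the norm. *)
have v_norm : b`_k.+1 * c b`_k.+1 = 1.
  have E1' : c b`_1 * b`_k.+1 = - w^-1 by rewrite -[X in _ * X]cK -rmorphM E1 rmorphN cw.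
  have : c b`_1 = - w^-1 * c b`_k.+1.
    by apply: (mulfI u0); rewrite Ek mulrCA E0; field.
  move=> E; move: E1'; rewrite E => E1'.
  have -> : b`_k.+1 * c b`_k.+1 = - w * (- w^-1 * c b`_k.+1 * b`_k.+1) by field.
  by rewrite E1'; field.
have v0 : c b`_k.+1 != 0.
  by apply: contra_eq_neq v_norm => ->; rewrite mulr0 eq_sym oner_eq0.
apply/polyP => i; rewrite coefZ /a coef_trinom //.
case: i => [|[|i]] /=.
- by apply: (mulIf v0); rewrite E0 mulrAC v_norm mul1r.
- by apply: (mulIf v0); rewrite E1 mulrAC v_norm mul1r.
- have [->|ik] := eqVneq i.+2 k.+1; first by rewrite mulr1.
  rewrite mulr0; have [le_ik|lt_ki] := leqP i.+2 k; first by rewrite midb.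
  by rewrite nth_default // (leq_trans szb) // ltn_neqAle eq_sym ik.
Qed.

(** On the unit circle [|z - 1|^2 + |z + 1|^2 = 4]. With [t = |z - 1|], the product form says
    [t^2 < 2 t], as needed below. *)
Lemma norm_sub1_lt2 (z : algC) : `|z| = 1 -> z != 1 -> z != -1 -> `|z - 1| * (`|z - 1| - 2) < 0.
Proof.
move=> z1 zn1 znN1.
have t0 : 0 < `|z - 1| by rewrite normr_gt0 subr_eq0.
rewrite pmulr_rlt0 // subr_lt0 -(@ltr_pXn2r _ 2) ?nnegrE ?normr_ge0 //.
have : 0 < `|z + 1| ^+ 2 by rewrite exprn_gt0 // normr_gt0 -[1]opprK subr_eq0.
suff -> : (2 : algC) ^+ 2 = `|z - 1| ^+ 2 + `|z + 1| ^+ 2 by rewrite ltrDl.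
have zz : z * z^* = 1 by rewrite -normCK z1 expr1n.
rewrite !normCK rmorphB rmorphD rmorph1.
have -> : (z - 1) * (z^* - 1) + (z + 1) * (z^* + 1) = z * z^* + z * z^* + 2 by ring.
by rewrite zz; ring.
Qed.

(** Two nonzero middle coefficients would each have mean square at least 1 over the conjugates,
    whereas in every embedding their squares add up to less than 2. *)
Lemma ljunggren_middle (n k : nat) (L : splittingFieldType rat) (f : {rmorphism L -> algC})
    (c : {rmorphism L -> L}) (w : L) (b : {poly L}) (a := trinom k w) :
    (2 < n)%N -> (1 < k)%N -> galois 1 {:L} -> (forall x, f (c x) = (f x)^*) ->
    n.-primitive_root w -> <<1; w>>%VS = fullv ->
    (forall i, f b`_i \in Aint) ->
    b * recip k.+1 (map_poly c b) = a * recip k.+1 (map_poly c a) ->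
  forall i j, (0 < i < j)%N -> (j <= k)%N -> b`_i != 0 -> b`_j == 0.
Proof.
move=> n2 k1 galL Dc prim_w genL Zb Eba i j /andP[i0 ij] jk bi0.
apply/negPn/negP => bj0.
set G := 'Gal({:L} / 1)%g.
have w0 : w != 0 by rewrite -(fmorph_eq0 f) -normr_eq0 (norm_prim_root f prim_w) oner_eq0.
have cw := prim_root_rmorph_inv Dc prim_w.
have [D0 _ _ Dk1] := trinom_coefs k1 w0 cw.
rewrite -/a -{}Eba !coef_mul_recip // in D0 Dk1.
rewrite big_ord1 subn0 addn0 in D0.
have sum_lt (s : gal_of {:L}) : `|f (s b`_i)| ^+ 2 + `|f (s b`_j)| ^+ 2 < 2.
  have pr_sw: n.-primitive_root (s w) by rewrite fmorph_primitive_root.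
  have pr_z: n.-primitive_root (f (s w)) by rewrite fmorph_primitive_root.
  set z := f (s w) in pr_z *.
  have nz : `|z| = 1 := norm_prim_root f pr_sw.
  have fsc x : f (s (c x)) = (f (s x))^* by rewrite (gal_conj_commute s Dc prim_w genL) Dc.
  have z1 : z != 1.
    by rewrite -[z]expr1 -(prim_order_dvd pr_z) gtnNdvd // (ltn_trans _ n2).
  have zN1 : z != -1.
    apply: contraTneq n2 => zN1; rewrite -leqNgt dvdn_leq //.
    by rewrite (prim_order_dvd pr_z) zN1 sqrrN expr1n.
  have P0 : `|f (s b`_0)| * `|f (s b`_k.+1)| = `|z - 1|.
    by rewrite -[in X in _ * X]norm_conjC -fsc -normrM -!rmorphM D0 !rmorphB !rmorph1.
  (* This is the coefficient of degree [k+1] of the autocorrelation identity, read in the embedding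
     [f \o s]. *)
  have Ptot : \sum_(l < k.+2) `|f (s b`_l)| ^+ 2 = 2 + `|z - 1| ^+ 2.
    have -> : 2 + `|z - 1| ^+ 2 = f (s (1 + w * w^-1 + (w - 1) * (w^-1 - 1))).
      rewrite -cw normCK !(rmorphD, rmorphM, rmorphN, rmorph1) /= fsc -/z.
      by rewrite -[z * _]normCK nz expr1n.
    rewrite -Dk1 !rmorph_sum; apply: eq_bigr => l _.
    by rewrite subnn add0n !rmorphM /= fsc normCK.
  have := norm_sub1_lt2 nz z1 zN1.
  set t := `|z - 1| in P0 Ptot *.
  rewrite mulrBr -expr2 subr_lt0 => t_lt.
  have le_tot : `|f (s b`_i)| ^+ 2 + `|f (s b`_j)| ^+ 2 + (`|f (s b`_0)| ^+ 2 + `|f (s b`_k.+1)| ^+ 2)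
      <= 2 + t ^+ 2.
    rewrite -Ptot.
    have ik2 : (i < k.+2)%N by lia.
    have jk2 : (j < k.+2)%N by lia.
    rewrite (bigD1 (Ordinal ik2)) //= -addrA lerD2l.
    rewrite (bigD1 (Ordinal jk2)) /=; last by rewrite -val_eqE /= gtn_eqF.
    rewrite lerD2l (bigD1 ord0) /=; last by rewrite -!val_eqE /= !ltn_eqF //; lia.
    rewrite lerD2l (bigD1 ord_max) /=; last first.
      by rewrite -!val_eqE /= !gtn_eqF //; lia.
    by rewrite lerDl sumr_ge0 // => l _; rewrite exprn_ge0.
  (* The two middle terms have total at most 2 + t^2 - (|b_0|^2 + |b_(k+1)|^2)
     <= 2 + t^2 - 2t < 2 by AM-GM and [P0]. *)
  have amgm : t * 2 <= `|f (s b`_0)| ^+ 2 + `|f (s b`_k.+1)| ^+ 2.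
    rewrite -P0 -subr_ge0.
    set p := `|f _|; set q := `|f _|.
    have -> : p ^+ 2 + q ^+ 2 - p * q * 2 = (p - q) ^+ 2 by ring.
    by rewrite real_exprn_even_ge0 // rpredB ?normr_real.
  rewrite -(ltrD2r (t * 2)); apply: le_lt_trans (_ : 2 + t ^+ 2 < _).
    by apply: le_trans le_tot; rewrite lerD2l.
  by rewrite ltrD2l.
(* Summing over the Galois group gives at least [2 #|G|] by integrality and less than [2 #|G|] by
   [sum_lt]. *)
have := lerD (galois_sum_norm_ge galL bi0 (Zb i)) (galois_sum_norm_ge galL bj0 (Zb j)).
rewrite -big_split /= lt_geF //.
apply: lt_le_trans (_ : \sum_(s in G) 2 <= _); last first.
  by rewrite sumr_const -mulr2n -!mulrnA mulnC.
apply: ltr_sum => [|s _]; last exact: sum_lt.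
by apply/hasP; exists 1%g; rewrite ?mem_index_enum ?group1.
Qed.

(** If [b_1] is nonzero it is the only middle coefficient, and [b] is proportional to [a]. Otherwise
    the only one is [b_k], and the same argument applies to the conjugate reciprocal. *)
Lemma ljunggren (n k : nat) (L : splittingFieldType rat) (f : {rmorphism L -> algC})
    (c : {rmorphism L -> L}) (w : L) (b : {poly L}) (a := trinom k w) :
    (2 < n)%N -> (1 < k)%N -> galois 1 {:L} -> (forall x, f (c x) = (f x)^*) ->
    n.-primitive_root w -> <<1; w>>%VS = fullv ->
    (size b <= k.+2)%N -> (forall i, f b`_i \in Aint) ->
    b * recip k.+1 (map_poly c b) = a * recip k.+1 (map_poly c a) ->
  exists v, b = v *: a \/ b = v *: recip k.+1 (map_poly c a).
Proof.
move=> n2 k1 galL Dc prim_w genL szb Zb Eba.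
have mid := ljunggren_middle n2 k1 galL Dc prim_w genL Zb Eba.
have w0 : w != 0 by rewrite -(fmorph_eq0 f) -normr_eq0 (norm_prim_root f prim_w) oner_eq0.
have w1 : w != 1 by rewrite -[w]expr1 -(prim_order_dvd prim_w) gtnNdvd // (ltn_trans _ n2).
have cw := prim_root_rmorph_inv Dc prim_w.
have cK : involutive c by move=> x; apply: (fmorph_inj f); rewrite !Dc conjCK.
have cpK (p : {poly L}) : map_poly c (map_poly c p) = p.
  by rewrite -map_poly_comp map_poly_id // => x _ /=; rewrite cK.
have [b1|b1] := eqVneq b`_1 0; last first.
  exists b`_k.+1; left; apply: low_autocorrelation => // i i1 ik.
  by apply/eqP; apply: mid b1; rewrite ?i1.
(* The coefficient of degree 1 reads [b_0 * c b_k + b_1 * c b_(k+1) = - w]. *)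
have bk : b`_k != 0.
  have [_ D1 _ _] := trinom_coefs k1 w0 cw; rewrite -/a -{}Eba in D1.
  apply: contraNneq w0 => bk; rewrite -oppr_eq0 -D1 coef_mul_recip //.
  by rewrite 2!big_ord_recl big_ord0 /= addn0 subn1 /= bk b1 rmorph0 mulr0 mul0r !addr0.
(* The conjugate reciprocal [b'] of [b] falls under the previous case. *)
pose b' := recip k.+1 (map_poly c b).
have Db : recip k.+1 (map_poly c b') = b.
  by rewrite -map_recip recipK ?cpK // size_map_poly.
exists (c b'`_k.+1); right; rewrite -[b in LHS]Db -recipZ -map_polyZ; congr (recip _ (map_poly c _)).
apply: low_autocorrelation => // [|i i1 ik|]; first exact: size_recip.
  rewrite coef_recip ?(leq_trans ik) // coef_map /=.
  have [->|bi] := eqVneq b`_(k.+1 - i) 0; first by rewrite rmorph0.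
  have /eqP bk0 : b`_k == 0 by apply: mid bi => //; lia.
  by rewrite bk0 eqxx in bk.
by rewrite Db mulrC.
Qed.

(** * Factors of the trinomial and of its conjugate reciprocal *)

Lemma recip_trinom (L : fieldType) (k : nat) (c : {rmorphism L -> L}) (w : L) :
    (1 < k)%N -> c w = w^-1 ->
  recip k.+1 (map_poly c (trinom k w)) = (w^-1 - 1) *: 'X^(k.+1) - w^-1 *: 'X^k + 1.
Proof.
move=> k1 cw; apply/polyP => i.
rewrite !(coefD, coefN, coefZ, coefXn, coef1).
have [le_ik|lt_ki] := leqP i k.+1; last first.
  by rewrite nth_default ?(leq_trans (size_recip _ _)) // !gtn_eqF ?mulr0 ?subr0 ?addr0 //; lia.
rewrite coef_recip // coef_map coef_trinom //.
have [->|ik1] := eqVneq i k.+1.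
  by rewrite subnn /= rmorphB rmorph1 cw gtn_eqF // mulr1 mulr0 subr0 addr0.
rewrite [_ == 0%N]gtn_eqF ?subn_gt0 ?ltn_neqAle ?ik1 // mulr0 sub0r.
have [->|ik] := eqVneq i k.
  by rewrite subSnn /= rmorphN cw gtn_eqF ?(ltn_trans _ k1) // mulr1 addr0.
rewrite [_ == 1%N](_ : _ = false) ?mulr0 ?oppr0 ?add0r; last by apply/negP => /eqP; lia.
rewrite (_ : (_ - i == _)%N = (i == 0%N)); last by apply/eqP/eqP; lia.
by case: (i == 0%N); rewrite /= ?rmorph1 ?rmorph0.
Qed.

(** A combination of the two trinomials that cancels the terms of degree [k+2] and [k+1] leaves the
    quadratic, scaled by [1 - w]. *)
Lemma dvdp_trinom_recip (L : fieldType) (k : nat) (c : {rmorphism L -> L}) (w : L)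
    (d : {poly L}) :
    (1 < k)%N -> c w = w^-1 -> w != 0 -> w != 1 ->
    d %| trinom k w -> d %| recip k.+1 (map_poly c (trinom k w)) ->
  d %| ('X - 1) * ('X + w^-1%:P).
Proof.
move=> k1 cw w0 w1 da da'.
have w1' : 1 - w != 0 by rewrite subr_eq0 eq_sym.
rewrite -(dvdpZr _ _ w1').
have -> : (1 - w) *: (('X - 1) * ('X + w^-1%:P)) =
    'X * recip k.+1 (map_poly c (trinom k w))
      - ((w^-1 - 1) *: 'X - w^-1%:P) * trinom k w.
  have ww : w%:P * w^-1%:P = 1 :> {poly L} by rewrite -polyCM mulfV.
  rewrite (recip_trinom k1 cw) /trinom !exprS -!mul_polyC !polyCB polyC1.
  move: (w%:P) (w^-1%:P) ww => y z yz.
  apply/eqP; rewrite -subr_eq0; apply/eqP.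
  (* With [y] and [z] independent, the two sides differ by a multiple of [1 - y * z]. *)
  transitivity ((1 - y * z) * ('X ^+ 2 - 'X)); first by ring.
  by rewrite yz subrr mul0r.
by rewrite dvdp_sub ?dvdp_mull.
Qed.

(** A root [x] other than 1 satisfies [1 + x + ... + x^k = w], so it is a root of the monic integer
    polynomial ['Phi_n \Po S]. *)
Lemma Aint_trinom_root (n k : nat) (w x : algC) :
  (1 < k)%N -> n.-primitive_root w -> root (trinom k w) x -> x \in Aint.
Proof.
move=> k1 prim_w.
pose S : {poly int} := \sum_(i < k.+1) 'X^i.
have DS : S = \poly_(i < k.+1) 1.
  by rewrite poly_def; apply: eq_bigr => i _; rewrite scale1r.
have szS : size S = k.+1 by rewrite DS size_poly_eq ?oner_eq0.
have monS : S \is monic by rewrite monicE lead_coefE szS DS coef_poly ltnSn.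
have mapS : map_poly intr S = \sum_(i < k.+1) 'X^i :> {poly algC}.
  by rewrite rmorph_sum; apply: eq_bigr => i _ /=; rewrite map_polyXn.
have -> : trinom k w = ('X - 1) * (map_poly intr S - w%:P).
  by rewrite mulrBr mapS -subrX1 /trinom -mul_polyC polyCB polyC1; ring.
rewrite rootM => /orP[|rS]; first by rewrite root_XsubC => /eqP ->; apply: Aint1.
apply: (@root_monic_Aint (map_poly intr ('Phi_n \Po S))).
- rewrite map_comp_poly (Cintr_Cyclotomic prim_w) /root horner_comp.
  have := root_cyclotomic prim_w w; rewrite prim_w /root => /eqP <-.
  move: rS; rewrite /root !hornerE subr_eq0 => /eqP ->.
  by [].
- apply: monic_map; rewrite monicE lead_coef_comp ?szS // ?ltnS ?(ltnW k1) //.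
  by rewrite (monicP monS) expr1n mulr1 (monicP (Cyclotomic_monic n)).
- by apply/polyOverP => i; rewrite coef_map /= intr_int.
Qed.

Lemma Aint_monic_factor (p : {poly algC}) :
    p \is monic -> (forall x, root p x -> x \in Aint) ->
  p \is a polyOver Aint.
Proof.
move=> mon_p Zp; have [r Dp] := closed_field_poly_normal p.
rewrite (monicP mon_p) scale1r in Dp.
rewrite Dp big_seq; apply: rpred_prod => x rx.
by rewrite polyOverXsubC Zp // Dp root_prod_XsubC.
Qed.

Lemma trinom_monic (R : nzRingType) (k : nat) (w : R) : (1 < k)%N -> trinom k w \is monic.
Proof.
move=> k1; rewrite monicE lead_coefE size_trinom // coef_trinom //.
by rewrite eqxx eqSS [k == _]gtn_eqF // ltnW.
Qed.

Lemma trinom_monic_factors (n k : nat) (L : splittingFieldType rat)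
    (f : {rmorphism L -> algC}) (c : {rmorphism L -> L}) (w : L) (p q : {poly L}) :
    (2 < n)%N -> (1 < k)%N -> galois 1 {:L} -> (forall x, f (c x) = (f x)^*) ->
    n.-primitive_root w -> <<1; w>>%VS = fullv ->
    p \is monic -> q \is monic -> trinom k w = p * q ->
  p %| ('X - 1) * ('X + w^-1%:P) \/ q %| ('X - 1) * ('X + w^-1%:P).
Proof.
move=> n2 k1 galL Dc prim_w genL mon_p mon_q Da.
have w0 : w != 0 by rewrite -(fmorph_eq0 f) -normr_eq0 (norm_prim_root f prim_w) oner_eq0.
have w1 : w != 1 by rewrite -[w]expr1 -(prim_order_dvd prim_w) gtnNdvd // (ltn_trans _ n2).
have cw := prim_root_rmorph_inv Dc prim_w.
have cK : involutive c by move=> x; apply: (fmorph_inj f); rewrite !Dc conjCK.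
have cpK (r : {poly L}) : map_poly c (map_poly c r) = r.
  by rewrite -map_poly_comp map_poly_id // => x _ /=; rewrite cK.
have p0 := monic_neq0 mon_p; have q0 := monic_neq0 mon_q.
set m := (size p).-1; set l := (size q).-1.
have szp : size p = m.+1 by rewrite prednK ?size_poly_gt0.
have szq : size q = l.+1 by rewrite prednK ?size_poly_gt0.
have ml : k.+1 = (m + l)%N.
  by have := size_trinom w k1; rewrite Da size_mul // szp szq addnS addSn /= => -[].
pose p' := recip m (map_poly c p); pose q' := recip l (map_poly c q).
have Da' : recip k.+1 (map_poly c (trinom k w)) = p' * q'.
  by rewrite Da rmorphM ml recipM // size_map_poly ?szp ?szq.
have Zcoef (r s : {poly L}) : r \is monic -> trinom k w = r * s ->
    map_poly f r \is a polyOver Aint.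
  move=> mon_r Drs; apply: Aint_monic_factor => [|x rx]; first by rewrite map_monic.
  apply: (@Aint_trinom_root n k (f w)); rewrite ?fmorph_primitive_root //.
  have <- : map_poly f (trinom k w) = trinom k (f w).
    by apply/polyP => i; rewrite coef_map !coef_trinom //; do 2?case: ifP => _; rewrite /= ?rmorphB ?rmorphN ?rmorph1 ?rmorph_nat.
  by rewrite Drs rmorphM rootM rx.
(* The roots of [p] and [q] are algebraic integers, hence so are their coefficients; conjugation
   preserves this. *)
have Zb i : f (p * q')`_i \in Aint.
  rewrite coefM rmorph_sum; apply: rpred_sum => -[j /= Hj] _.
  rewrite rmorphM rpredM //; first by rewrite -coef_map (polyOverP (Zcoef _ _ _ Da)).
  rewrite coef_poly; case: ifP => _; last by rewrite rmorph0 Aint0.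
  by rewrite coef_map /= Dc Aint_aut -coef_map (polyOverP (Zcoef q p _ _)) // mulrC.
have q'0 : q' != 0.
  apply: contraNneq q0 => q'0.
  rewrite -(map_poly_eq0 c) -(@recipK _ l (map_poly c q)) ?size_map_poly ?szq // -/q' q'0.
  by apply/eqP/polyP => i; rewrite coef_poly !coef0 if_same.
have szb : (size (p * q')%R <= k.+2)%N.
  apply: leq_trans (size_polyMleq _ _) _; rewrite szp /= ml -addnS leq_add2l.
  exact: size_recip.
have Eb : p * q' * recip k.+1 (map_poly c (p * q')) =
    trinom k w * recip k.+1 (map_poly c (trinom k w)).
  rewrite Da' Da rmorphM ml recipM ?size_map_poly ?szp ?size_recip //.
  have -> : recip l (map_poly c q') = q by rewrite -map_recip recipK ?cpK ?size_map_poly ?szq.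
  by rewrite -/p'; ring.
(* Cancelling [p] or [q'] makes [q'] proportional to [q], or [p] to [p']; so [q], or [p], divides
   both trinomials. *)
have [v [Dv|Dv]] := ljunggren n2 k1 galL Dc prim_w genL szb Zb Eb.
- have Dq' : q' = v *: q by apply: (mulfI p0); rewrite Dv Da scalerAr.
  right; apply: (dvdp_trinom_recip k1 cw w0 w1); rewrite ?Da' ?Da ?dvdp_mull //.
  have v0 : v != 0 by apply: contraNneq q'0 => v0; rewrite Dq' v0 scale0r.
  by rewrite Dq' dvdpZr.
- have Dp : p = v *: p' by apply: (mulIf q'0); rewrite Dv Da' scalerAl.
  left; apply: (dvdp_trinom_recip k1 cw w0 w1); rewrite ?Da' ?Da ?dvdp_mulr //.
  have v0 : v != 0 by apply: contraNneq p0 => v0; rewrite Dp v0 scale0r.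
  by rewrite Dp dvdpZl.
Qed.

(** For [h = r q], one of [t r] and [q] divides the quadratic, up to scaling both to monic.
    Coprimality of [h] with it then makes [r] or [q] constant. *)
Lemma trinom_cofactor_irreducible (n k : nat) (L : splittingFieldType rat)
    (f : {rmorphism L -> algC}) (c : {rmorphism L -> L}) (w : L) (t h : {poly L}) :
    (2 < n)%N -> (1 < k)%N -> galois 1 {:L} -> (forall x, f (c x) = (f x)^*) ->
    n.-primitive_root w -> <<1; w>>%VS = fullv ->
    trinom k w = t * h -> (1 < size h)%N ->
    coprimep h (('X - 1) * ('X + w^-1%:P)) ->
  irreducible_poly h.
Proof.
move=> n2 k1 galL Dc prim_w genL Da szh co_h; split=> // q q1 /dvdpP[r Dh].
have mon_a := trinom_monic w k1.
have a0 := monic_neq0 mon_a.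
have h0 : h != 0 by rewrite -size_poly_gt0 ltnW.
have q0 : q != 0 by apply: contraNneq h0 => q0; rewrite Dh q0 mulr0.
have lq0 : lead_coef q != 0 by rewrite lead_coef_eq0.
have Da2 : trinom k w = (lead_coef q *: (t * r)) * ((lead_coef q)^-1 *: q).
  by rewrite -scalerAl -scalerAr scalerA divff // scale1r Da Dh mulrA.
have mon_q : (lead_coef q)^-1 *: q \is monic by rewrite monicE lead_coefZ mulVf.
have mon_tr : lead_coef q *: (t * r) \is monic by rewrite -(monicMr _ mon_q) -Da2.
have [] := trinom_monic_factors n2 k1 galL Dc prim_w genL mon_tr mon_q Da2.
- rewrite dvdpZl // => /(dvdp_trans (dvdp_mull t (dvdpp r))) r_e.
  have : coprimep r r by apply: coprimep_dvdl r_e (coprimep_dvdr _ co_h); rewrite Dh dvdp_mulr.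
  rewrite coprimepp => /eqP sz_r; have /size_poly1P[b b0 Dr] : size r == 1%N by apply/eqP.
  by rewrite Dh Dr mul_polyC eqp_sym eqp_scale.
- rewrite dvdpZl ?invr_eq0 // => q_e.
  have : coprimep q q by apply: coprimep_dvdl q_e (coprimep_dvdr _ co_h); rewrite Dh dvdp_mull.
  by rewrite coprimepp (negbTE q1).
Qed.

(** * Factorization of [Fnk] *)

Lemma trinomE (R : comNzRingType) (k : nat) (w : R) :
  trinom k w = ('X - 1) * (\sum_(i < k.+1) 'X^i - w%:P).
Proof. by rewrite mulrBr -subrX1 /trinom -mul_polyC polyCB polyC1; ring. Qed.

Lemma Fnk_norm_poly (n k : nat) (L : splittingFieldType rat)
    (f : {rmorphism L -> algC}) (w : L) :
    galois 1 {:L} -> n.-primitive_root w -> <<1; w>>%VS = fullv ->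
  map_poly (in_alg L) (Fnk n k) = norm_poly (\sum_(i < k.+1) 'X^i - w%:P).
Proof.
move=> galL prim_w genL.
have map_geom (R S : nzRingType) (phi : {rmorphism R -> S}) :
    map_poly phi (\sum_(i < k.+1) 'X^i) = \sum_(i < k.+1) 'X^i.
  by rewrite rmorph_sum; apply: eq_bigr => i _ /=; rewrite map_polyXn.
rewrite /Fnk map_comp_poly (Cyclotomic_norm_poly f galL prim_w genL) map_geom.
rewrite comp_prod_poly; apply: eq_bigr => s _.
by rewrite map_polyXsubC comp_polyB comp_polyX comp_polyC rmorphB /= map_polyC map_geom.
Qed.

Lemma root_trinom_opp_inv (L : fieldType) (k : nat) (w : L) : w != 0 ->
  root (trinom k w) (- w^-1) = (w ^+ k.+2 == (-1) ^+ k).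
Proof.
move=> w0; rewrite /root /trinom !hornerD hornerN hornerZ hornerXn hornerX hornerC.
have -> : (- w^-1) ^+ k.+1 = - ((-1) ^+ k / w ^+ k.+1).
  by rewrite [LHS]exprNn exprVn exprS; ring.
have -> : - ((-1) ^+ k / w ^+ k.+1) - w * - w^-1 + (w - 1) = (w ^+ k.+2 - (-1) ^+ k) / w ^+ k.+1.
  rewrite (exprS w k.+1); move: (w ^+ k.+1) ((-1) ^+ k) (expf_neq0 k.+1 w0) => y e y0.
  by field; apply/andP.
by rewrite mulf_eq0 invr_eq0 (negbTE (expf_neq0 _ w0)) orbF subr_eq0.
Qed.

(** For odd [k], the value is -1 iff its square is 1 and it is not 1. Given [n %| 2 * (k + 2)], it
    is 1 exactly when [n] is odd, because [k + 2] is odd. *)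
Lemma prim_root_expr_sign (n k : nat) (L : fieldType) (w : L) :
    (2 < n)%N -> n.-primitive_root w -> (2%:R : L) != 0 ->
  (w ^+ k.+2 == (-1) ^+ k) =
    if odd k then ~~ odd n && (n %| 2 * (k + 2))%N else (n %| k + 2)%N.
Proof.
move=> n2 prim_w two0; rewrite addn2 -[(-1) ^+ k]signr_odd.
case: ifP => odd_k; last by rewrite expr0 (prim_order_dvd prim_w).
rewrite expr1.
have N1 : (-1 : L) != 1 by rewrite eq_sym -subr_eq0 opprK -mulr2n.
rewrite (prim_order_dvd prim_w) mulnC exprM sqrf_eq1.
have [wN1|w_n1] := eqVneq (w ^+ k.+2) (-1).
  rewrite wN1 orbT andbT; apply/esym/negP => odd_n.
  have : (n %| k.+2 * 2)%N by rewrite (prim_order_dvd prim_w) exprM wN1 sqrrN expr1n.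
  rewrite Gauss_dvdl ?coprimen2 // (prim_order_dvd prim_w) wN1.
  exact/negP.
rewrite orbF; apply/esym/negP => /andP[/negP even_n].
rewrite -(prim_order_dvd prim_w) => dv_n; apply: even_n.
by apply: dvdn_odd dv_n _; rewrite /= negbK.
Qed.

(** Over [L], either [g] is irreducible or [g] is [X + 1/w] times an irreducible [h]; taking norms
    transfers this to the rationals. *)
Lemma Fnk_dichotomy (n k : nat) (hn : (2 < n)%N) (hk : (1 < k)%N) :
  if (if odd k then ~~ odd n && (n %| 2 * (k + 2))%N else (n %| k + 2)%N)
  then two_irreducible_factors (Fnk n k) else irreducible_poly (Fnk n k).
Proof.
have [L [f [c [w [galL Dc prim_w genL]]]]] := cyclotomic_field_exists (ltnW hn).
have natL i : ((i%:R : L) == 0) = (i == 0%N).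
  by rewrite -(fmorph_eq0 f) rmorph_nat pnatr_eq0.
rewrite -(prim_root_expr_sign _ hn prim_w) ?natL //.
have nw := norm_prim_root f prim_w.
have w0 : w != 0 by rewrite -(fmorph_eq0 f) -normr_eq0 nw oner_eq0.
rewrite -root_trinom_opp_inv //.
have DF := Fnk_norm_poly k f galL prim_w genL.
set g : {poly L} := \sum_(i < k.+1) 'X^i - w%:P in DF.
have Dg : g = map_poly (in_alg L) (\sum_(i < k.+1) 'X^i) - w%:P.
  by rewrite rmorph_sum; congr (_ - _); apply: eq_bigr => i _ /=; rewrite map_polyXn.
have Da : trinom k w = ('X - 1) * g by rewrite trinomE.
have co_g : coprime_conjugates g by rewrite Dg; apply: coprime_conjugates_XsubC.
have szg : size g = k.+1.
  have g0 : g != 0.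
    by apply: contraTneq (trinom_monic w hk) => g0; rewrite Da g0 mulr0 monicE lead_coef0 eq_sym oner_eq0.
  have szX1 : size ('X - 1 : {poly L}) = 2%N by rewrite -polyC1 size_XsubC.
  have X10 : ('X - 1 : {poly L}) != 0 by rewrite -size_poly_eq0 szX1.
  by have := size_trinom w hk; rewrite Da size_mul // szX1 /= => -[].
(* This serves twice: for [g(1) = k + 1 - w], and for the derivative [(k + 1) x^k - w] of the
   trinomial at [x = - 1/w]. *)
have large (x : L) : `|f x| = 1 -> k.+1%:R * x != w.
  move=> nx; apply/eqP => /(congr1 (fun y => `|f y|)).
  rewrite rmorphM normrM nx nw mulr1 rmorph_nat normr_nat => /eqP.
  by rewrite pnatr_eq1 eqSS => /eqP k0; move: hk; rewrite k0.
have g1 : ~~ root g 1.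
  rewrite /root /g hornerD hornerN hornerC horner_sum subr_eq0.
  under eq_bigr do rewrite hornerXn expr1n.
  by rewrite sumr_const card_ord -[_ *+ _]mulr1 large // rmorph1 normr1.
have wN1 : - w^-1 != 1.
  apply: contraTneq hn => /(congr1 (fun x => (- x)^-1)); rewrite opprK invrK invrN invr1 => wN1.
  by rewrite -leqNgt dvdn_leq // (prim_order_dvd prim_w) wN1 sqrrN expr1n.
have XN : 'X - (- w^-1)%:P = 'X + w^-1%:P by rewrite polyCN opprK.
have root_ag : root (trinom k w) (- w^-1) = root g (- w^-1).
  by rewrite Da rootM -polyC1 root_XsubC (negbTE wN1).
have co_E (h : {poly L}) : ~~ root h 1 -> ~~ root h (- w^-1) ->
    coprimep h (('X - 1) * ('X + w^-1%:P)).
  by move=> h1 he; rewrite coprimepMr -XN -polyC1 !coprimep_XsubC h1 he.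
have irr_h t h : trinom k w = t * h -> (1 < size h)%N -> ~~ root h 1 ->
    ~~ root h (- w^-1) -> irreducible_poly h.
  move=> Dth szh h1 he.
  exact: (trinom_cofactor_irreducible hn hk galL Dc prim_w genL Dth szh (co_E h h1 he)).
case: ifP => [|/negbT] ge; last first.
  rewrite root_ag in ge; apply: (norm_poly_irreducible (irr_h _ _ Da _ g1 ge) co_g); last by rewrite DF eqpxx.
  by rewrite szg ltnS ltnW.
have [h Dh] : exists h, g = h * ('X - (- w^-1)%:P) by apply/factor_theorem; rewrite -root_ag.
have h1 : ~~ root h 1 by apply: contra g1; rewrite Dh rootM => ->.
(* The root is simple: a double one would also annihilate the derivative, against [large]. *)
have he : ~~ root h (- w^-1).
  apply/negP => /factor_theorem[r Dr].
  have : (trinom k w)^`().[- w^-1] = 0.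
    by rewrite Da Dh Dr !derivM !hornerE derivXsubC !hornerE /= subrr; ring.
  rewrite /trinom !derivE !hornerE /= => /eqP.
  rewrite subr_eq0 hornerMn hornerXn -mulr_natl; apply/negP; apply: large.
  by rewrite rmorphXn normrX rmorphN normrN fmorphV normfV nw invr1 expr1n.
have Da2 : trinom k w = ('X - 1) * ('X - (- w^-1)%:P) * h.
  by rewrite Da Dh mulrAC mulrA.
have szh : (1 < size h)%N.
  have h0 : h != 0 by apply: contraNneq h1 => ->; rewrite root0.
  by move: szg; rewrite Dh size_Mmonic ?monicXsubC // size_XsubC addn2 /= => -[->].
have irr_hh := irr_h _ _ Da2 szh h1 he.
have co_h : coprime_conjugates h.
  by apply: coprime_conjugates_dvd co_g; rewrite Dh dvdp_mulr.
have [p Dp] := norm_poly_descent h galL.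
have [q Dq] := norm_poly_descent ('X - (- w^-1)%:P) galL.
exists p, q; split.
- by apply: (norm_poly_irreducible irr_hh co_h); rewrite Dp eqpxx.
- apply: (norm_poly_irreducible (irredp_XsubC (- w^-1))); last by rewrite Dq eqpxx.
  by apply: coprime_conjugates_dvd co_g; rewrite Dh dvdp_mull.
(* The factors are told apart by [- 1/w], a root of [q] only: [h] does not vanish there, and the
   other conjugates of [h] are coprime to its multiple [g], which does. *)
- rewrite -(eqp_map (in_alg L)) Dp Dq.
  apply/negP => /eqp_root/(_ (- w^-1)).
  rewrite -[X in _ = X -> _]dvdp_XsubCl dvdp_norm_poly; apply/negP.
  rewrite -coprimep_XsubC coprimep_sym; apply: coprimep_prodr => s Gs.
  have [->|s1] := eqVneq s 1%g.
    by rewrite map_poly_id => [|x _]; rewrite ?gal_id // coprimep_sym coprimep_XsubC.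
  apply: coprimep_dvdl (coprimep_dvdr _ (co_g s Gs s1)).
    by rewrite dvdp_map Dh dvdp_mulr.
  by rewrite Dh dvdp_mull.
- by apply: (map_poly_inj (in_alg L : {rmorphism rat -> L})); rewrite DF Dh norm_polyM rmorphM /= Dp Dq.
Qed.

Theorem theorem1p4 (n k : nat) (hn : (2 < n)%N) (hk : (1 < k)%N) :
  (~~ odd k ->
     (reducible_poly (Fnk n k) <-> (n %| k + 2)%N) /\
     (reducible_poly (Fnk n k) -> two_irreducible_factors (Fnk n k))) /\
  (odd k ->
     (reducible_poly (Fnk n k) <-> ~~ odd n /\ (n %| 2 * (k + 2))%N) /\
     (reducible_poly (Fnk n k) -> two_irreducible_factors (Fnk n k))).
Proof.
have two_red : two_irreducible_factors (Fnk n k) -> reducible_poly (Fnk n k).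
  by case=> q [r [[szq _] [szr _] _ Dqr]]; exists q, r.
have irr_nred : irreducible_poly (Fnk n k) -> ~ reducible_poly (Fnk n k).
  by move=> irr [q [r [szq szr /eqP]]]; apply/negP/irreducible_not_reducible.
split=> [/negbTE|] odd_k; move: (Fnk_dichotomy hn hk); rewrite odd_k.
  case: ifP => C; first by split=> //; split=> // _; apply: two_red.
  by move=> /irr_nred nred; split.
case: ifP => [/andP C two|C /irr_nred nred].
  by split=> //; split=> // _; apply: two_red.
by split=> //; split=> // /andP; rewrite C.
Qed.
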